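(* Let $(S,\mathcal S)$ be a measurable space, let $r\geq 2$, let $h\colon S^r\to\mathbb R$ be a symmetric measurable function and let $(X_i)_{i\geq 1}$ be an i.i.d. sequence of random variables with values in $S$. Suppose that $h$ is degenerated of order $i-1$ where $i\in\{2,\dots,r\}$. Let $\alpha\in(r-i/2,r)$. If there exists $\gamma>0$ such that $\mathbb E\left[\exp\left(R\,|h(X_1,\dots,X_r)|^\gamma\right)\right]<+\infty$ for all $R$, then for all $\varepsilon>0$, $$\sum_{N\geq 1}\exp\left(2^{N\left(\alpha-(r-i/2)\right)\frac{2\gamma}{i\gamma+2}}\right)\mathbb P\left\{\max_{r\leq n\leq 2^N}|U_n|>\varepsilon 2^{N\alpha}\right\}<+\infty.$$
   Context: For $n\geq r$, $U_n=U_{r,n}(h):=\sum_{1\leq i_1<\dots<i_r\leq n}h(X_{i_1},\dots,X_{i_r})$. An empty maximum (when $2^N<r$) is understood to be $0$. The kernel $h$ is symmetric if it is invariant under all permutations of its $r$ arguments. Degeneracy: let $Y:=h(X_1,\dots,X_r)$ be integrable and let $\mathcal F_j$ be the $\sigma$-algebra generated by $X_1,\dots,X_j$. For $i\in\{2,\dots,r\}$, $h$ is degenerated of order $i-1$ if $\mathbb E[Y\mid\mathcal F_{i-1}]=0$ almost surely but $\mathbb E[Y\mid\mathcal F_i]$ is not almost surely equal to zero. *)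

(* Defs.v *)
From mathcomp Require Import all_boot all_order all_algebra all_fingroup.
From mathcomp Require Import finmap.
From mathcomp Require Import all_classical all_reals all_analysis.

Set Implicit Arguments.
Unset Strict Implicit.
Unset Printing Implicit Defensive.

Import Order.TTheory GRing.Theory Num.Theory.
Import numFieldNormedType.Exports.

Local Open Scope classical_set_scope.
Local Open Scope ring_scope.

(* Sequences of random variables are indexed from 0: [X k] stands for the
   variable written X_(k+1) with indices starting from 1. *)

Definition mutually_independent d d' (T : measurableType d)
    (S : measurableType d') (R : realType) (P : probability T R)
    (X : nat -> {RV P >-> S}) : Prop :=
  forall (J : {fset nat}) (A : nat -> set S),
    (forall k, measurable (A k)) ->
    P (\bigcap_(k in [set` J]) (X k @^-1` A k)) =
    (\prod_(k <- J) P (X k @^-1` A k))%E.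

(* Laws are compared on measurable sets only: [distribution P (X k)] is a set
   function defined on all subsets of [S]. *)
Definition identically_distributed d d' (T : measurableType d)
    (S : measurableType d') (R : realType) (P : probability T R)
    (X : nat -> {RV P >-> S}) : Prop :=
  forall (k : nat) (A : set S), measurable A ->
    distribution P (X k) A = distribution P (X 0%N) A.

Definition iid d d' (T : measurableType d) (S : measurableType d')
    (R : realType) (P : probability T R) (X : nat -> {RV P >-> S}) : Prop :=
  mutually_independent X /\ identically_distributed X.

Definition symmetric_kernel (S R : Type) (r : nat) (h : r.-tuple S -> R) :
    Prop :=
  forall (s : 'S_r) (x : r.-tuple S), h [tuple tnth x (s k) | k < r] = h x.

Definition Ustat d d' (T : measurableType d) (S : measurableType d')
    (R : realType) (P : probability T R) (r : nat) (h : r.-tuple S -> R)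
    (X : nat -> {RV P >-> S}) (n : nat) (w : T) : R :=
  \sum_(t : r.-tuple 'I_n | sorted ltn [seq val j | j <- t])
    h (map_tuple (fun j : 'I_n => X j w) t).

Definition kernel_sample d d' (T : measurableType d) (S : measurableType d')
    (R : realType) (P : probability T R) (r : nat) (h : r.-tuple S -> R)
    (X : nat -> {RV P >-> S}) (w : T) : R :=
  h [tuple X k w | k < r].

(* sigma(X_1, ..., X_j) *)
Definition natural_filtration d d' (T : measurableType d)
    (S : measurableType d') (R : realType) (P : probability T R)
    (X : nat -> {RV P >-> S}) (j : nat) : set (set T) :=
  g_sigma_preimage (fun k : 'I_j => X k : T -> S).

(* [Z] is a version of E[Y | G]. *)
Definition is_cond_expectation d (T : measurableType d) (R : realType)
    (P : probability T R) (G : set (set T)) (Y Z : T -> R) : Prop :=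
  [/\ forall B : set R, measurable B -> G (Z @^-1` B),
      P.-integrable [set: T] (EFin \o Z) &
      forall A, G A ->
        (\int[P]_(w in A) (Z w)%:E = \int[P]_(w in A) (Y w)%:E)%E].

(* Versions of a conditional expectation are almost surely equal, so each
   condition below does not depend on the version. *)
Definition degenerated_of_order d d' (T : measurableType d)
    (S : measurableType d') (R : realType) (P : probability T R) (r : nat)
    (h : r.-tuple S -> R) (X : nat -> {RV P >-> S}) (m : nat) : Prop :=
  let Y := kernel_sample h X in
  let F := natural_filtration X in
  [/\ P.-integrable [set: T] (EFin \o Y),
      exists2 Z, is_cond_expectation P (F m) Y Z &
        {ae P, forall w, Z w = 0} &
      exists2 Z, is_cond_expectation P (F m.+1) Y Z &
        ~ {ae P, forall w, Z w = 0}].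

(* Main.v *)
(* Since [2q] is even, E|U_n|^(2q) expands into a sum, over families
   (I_1, ..., I_2q) of r-subsets of {1, ..., n}, of the expectations
   E[h(X_I1) ... h(X_I2q)]. If some I_l shares fewer than i indices with the
   union of the others, degeneracy makes the expectation vanish; otherwise
   AM-GM bounds it by E|Y|^(2q). In the latter case an element of I_l belongs
   to no other set for at most r - i of its r elements, so the union of the
   family has at most m = q(2r - i) elements, and there are at most
   'C(n, m) m^(2qr) <= e^m n^m m^(qi) such families. This gives
     E|U_n|^(2q) <= e^m n^m m^(qi) E|Y|^(2q),
   while the exponential moments of |Y|^gamma give
   E|Y|^(2q) <= K_D (q^(2/gamma) / D)^q for every D > 0. Markov's inequality
   with q of the order of y = 2^(N (alpha - (r - i/2)) 2 gamma / (i gamma + 2))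
   and D large makes P(|U_n| > eps 2^(N alpha)) at most K exp(- 2 y) uniformly
   in n <= 2^N, and a union bound over n suffices for the maximum. *)

Require Import Defs.
From HB Require Import structures.
From mathcomp Require Import all_boot all_order all_algebra all_fingroup.
From mathcomp Require Import finmap.
From mathcomp Require Import all_classical all_reals all_analysis.
From mathcomp Require Import measurable_realfun measurable_fun_approximation.
From mathcomp Require Import zify ring.

Set Implicit Arguments.
Unset Strict Implicit.
Unset Printing Implicit Defensive.

Import Order.TTheory GRing.Theory Num.Theory.
Import numFieldNormedType.Exports.

(** * Families of tuples with shared entries *)

(** Double counting. At most [r - i] elements of [F l] lie in no other set, so [F l] contributes at
    most [r + (r - i)] to a count in which every element of the union is counted at least twice. *)
Lemma card_bigcup_shared (I T : finType) (F : I -> {set T}) (r i : nat) :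
  (forall l, #|F l| = r) ->
  (forall l, i <= #|F l :&: \bigcup_(l' | l' != l) F l'|)%N ->
  (2 * #|\bigcup_l F l| <= #|I| * (2 * r - i))%N.
Proof.
move=> Fr Fi; pose O l := (\bigcup_(l' | l' != l) F l')%SET.
have -> : (2 * #|\bigcup_l F l| = \sum_(x in (\bigcup_l F l)%SET) 2)%N.
  by rewrite sum_nat_const mulnC.
apply: (@leq_trans (\sum_(x : T) \sum_l ((x \in F l) + (x \in F l :\: O l)))%N).
  (* An element lying in a single F l is counted twice thanks to F l :\: O l. *)
  rewrite big_mkcond/=; apply: leq_sum => x _.
  case: ifPn => // /finset.bigcupP[l0 _ xl0].
  rewrite (bigD1 l0)//= xl0 inE xl0 andbT.
  case: (boolP (x \in O l0)) => [/finset.bigcupP[l1 l10 xl1]|_] //=.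
  by rewrite (bigD1 l1)//= xl1.
rewrite exchange_big/= -sum_nat_const; apply: leq_sum => l _.
have cardE (A : {set T}) : (\sum_x (x \in A) = #|A|)%N.
  by rewrite -sum1_card [RHS]big_mkcond/=; apply: eq_bigr => x _; case: (x \in A).
rewrite big_split/= !cardE cardsD Fr.
have := Fi l; rewrite -/(O l).
have : (#|F l :&: O l| <= r)%N by rewrite -(Fr l) subset_leq_card// subsetIl.
by lia.
Qed.

Lemma leq_card_tuple_in (T : finType) (A : {set T}) (r : nat) :
  (#|[set u : r.-tuple T | all (mem A) u]| <= #|A| ^ r)%N.
Proof.
rewrite -[X in (_ <= _ ^ X)%N](card_ord r) -(card_ffun_on _ (mem A)).
apply: leq_trans (leq_image_card
  (fun f : {ffun 'I_r -> T} => [tuple f k | k < r]) _).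
apply: subset_leq_card; apply/fintype.subsetP => u; rewrite inE => /allP uA.
apply/fintype.imageP; exists [ffun k => tnth u k].
  by apply/ffun_onP => k; rewrite ffunE; apply: uA; exact: mem_tnth.
by apply: eq_from_tnth => k; rewrite tnth_mktuple ffunE.
Qed.

Definition tuple_set (T : finType) (r : nat) (u : r.-tuple T) : {set T} :=
  [set x in u].

(** The index families that may survive in the expansion of the [p]-th moment. Entries are only
    asked to be distinct, not increasing; this overcounts, which is harmless for an upper bound. *)
Definition shared_families (p r i n : nat) : {set {ffun 'I_p -> r.-tuple 'I_n}} :=
  [set t : {ffun 'I_p -> r.-tuple 'I_n} | [forall l, uniq (t l) &&
    (i <= #|tuple_set (t l) :&: \bigcup_(l' | l' != l) tuple_set (t l')|)%N]].

Lemma leq_card_shared_families (p r i n : nat) :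
  (#|shared_families p r i n| <= (n ^ r) ^ p)%N.
Proof.
by rewrite (leq_trans (max_card _))// card_ffun card_tuple !card_ord.
Qed.

(** The entries of a shared family form a set of at most [m] elements, by [card_bigcup_shared] with
    [2q] sets. Choose an [m]-set [A] containing them, then each of the [2q] tuples among the at most
    [m ^ r] tuples over [A]. *)
Lemma card_shared_families (q r i n : nat) (m := (q * (2 * r - i))%N) :
  (m <= n)%N ->
  (#|shared_families q.*2 r i n| <= 'C(n, m) * (m ^ r) ^ q.*2)%N.
Proof.
move=> mn; pose B (A : {set 'I_n}) := [set t : {ffun 'I_q.*2 -> r.-tuple 'I_n} |
  t \in ffun_on (mem [set u : r.-tuple 'I_n | all (mem A) u])].
apply: (@leq_trans #|\bigcup_(A in [set A : {set 'I_n} | #|A| == m]) B A|).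
  apply: subset_leq_card; apply/fintype.subsetP => t; rewrite inE => /forallP tP.
  pose U := \bigcup_l tuple_set (t l).
  have Um : (#|U| <= m)%N.
    rewrite -(leq_pmul2l (isT : 0 < 2)%N) /m.
    rewrite mulnA [X in (_ <= X * _)%N]mul2n -[X in (_ <= X * _)%N]card_ord.
    apply: (@card_bigcup_shared _ _ (fun l => tuple_set (t l)) r i) => l;
      case/andP: (tP l) => // tl _.
    by rewrite /tuple_set cardsE (card_uniqP tl) size_tuple.
  (* [U] is completed to exactly [m] elements by drawing the missing ones from its complement, which
     is possible since [m <= n]. *)
  have [A UA Am] : exists2 A : {set 'I_n}, U \subset A & #|A| == m.
    pose k := (m - #|U|)%N.
    have : (0 < #|[set D : {set 'I_n} | D \subset ~: U & #|D| == k]|)%N.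
      by rewrite cards_draws bin_gt0 leq_subLR cardsC card_ord.
    move=> /card_gt0P[D]; rewrite inE => /andP[DU /eqP Dk].
    exists (U :|: D); first exact: finset.subsetUl.
    rewrite cardsU Dk (_ : U :&: D = finset.set0) ?cards0 /k ?subn0 ?subnKC//.
    by apply: disjoint_setI0; rewrite disjoint_sym finset.disjoints_subset.
  apply/finset.bigcupP; exists A; rewrite !inE//.
  apply/ffun_onP => l; rewrite inE; apply/allP => x xl /=.
  by apply: (fintype.subsetP UA); apply/finset.bigcupP; exists l => //; rewrite inE.
apply: (@leq_trans (\sum_(A in [set A : {set 'I_n} | #|A| == m]) #|B A|)).
  elim/big_rec2: _ => [|A k U' _ IH]; first by rewrite cards0.
  by rewrite cardsU (leq_trans (leq_subr _ _))// leq_add2l.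
rewrite -[X in 'C(X, _)](card_ord n) -card_draws -sum_nat_const.
apply: leq_sum => A; rewrite inE => /eqP Am.
rewrite cardsE card_ffun_on card_ord.
have [->//|q0] := posnP q.
by rewrite leq_exp2r ?double_gt0// -Am leq_card_tuple_in.
Qed.

Local Open Scope classical_set_scope.
Local Open Scope ring_scope.

(** * Real estimates *)

(** AM-GM applied to the powers [a l ^+ p], whose product is the [p]-th power of the left-hand
    side. *)
Lemma prod_le_mean_expn (R : realFieldType) (p : nat) (a : 'I_p -> R) :
  (0 < p)%N -> (forall l, 0 <= a l) ->
  \prod_l a l <= \sum_l (p%:R^-1 * a l ^+ p).
Proof.
move=> p0 a0.
have s0 : 0 <= \sum_l (p%:R^-1 * a l ^+ p).
  by apply: sumr_ge0 => l _; rewrite mulr_ge0 ?invr_ge0 ?ler0n ?exprn_ge0.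
rewrite -(@ler_pXn2r _ p)// ?nnegrE ?prodr_ge0//.
rewrite -prodrXl -mulr_sumr mulrC.
have [+ _] := leif_AGM (A := [pred _ : 'I_p | true]) (E := fun l => a l ^+ p)
  (fun l _ => exprn_ge0 p (a0 l)).
by rewrite /= cardT size_enum_ord.
Qed.

(** Here [r * 2q = m + q * i]. If [m <= n], use ['C(n, m) <= n ^ m / m!] and [m ^ m / m! <= e ^ m],
    a single term of the exponential series. If [n < m], the total number of families is
    [n ^ (m + q * i)], and [n ^ (q * i) <= m ^ (q * i)]. *)
Lemma card_shared_families_le (R : realType) (q r i n : nat)
    (m := (q * (2 * r - i))%N) : (i <= r)%N ->
  #|shared_families q.*2 r i n|%:R <=
    expR m%:R * (n%:R ^+ m * m%:R ^+ (q * i)) :> R.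
Proof.
move=> ir; have rqE : (r * q.*2 = m + q * i)%N by rewrite /m -muln2; nia.
have e1 : 1 <= expR m%:R :> R by apply: le_trans (expR_ge1Dx _); rewrite lerDl.
have [mn|/ltnW nm] := leqP m n; last first.
  apply: (@le_trans _ _ (n%:R ^+ (m + q * i))).
    by rewrite -natrX ler_nat -rqE expnM leq_card_shared_families.
  rewrite -[leLHS]mul1r ler_pM ?exprn_ge0// exprD ler_wpM2l ?exprn_ge0//.
  by rewrite lerXn2r ?nnegrE// ler_nat.
apply: (@le_trans _ _ ('C(n, m) * (m ^ r) ^ q.*2)%N%:R).
  by rewrite ler_nat; exact: card_shared_families.
have fact0 : 0 < m`!%:R :> R by rewrite ltr0n fact_gt0.
rewrite -expnM rqE expnD mulnA natrM mulrA natrX.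
rewrite ler_wpM2r ?exprn_ge0// -(ler_pM2r fact0) natrM natrX.
rewrite mulrAC -natrM bin_ffact mulrAC mulrC ler_pM ?exprn_ge0//.
  rewrite -ler_pdivrMr//; case: (m) => [|m']; first by rewrite expr0 divr1 expR0.
  by apply: le_trans (expR_ge1Dxn m' _); rewrite ?lerDr.
rewrite -natrX ler_nat; elim: (m) => [|k ih]; first by rewrite ffactn0.
by rewrite ffactnSr expnSr leq_mul ?leq_subr.
Qed.

(* The inequality [1 + x <= expR x] at [x = ln (t ^ gamma * D ^ (gamma / 2) / q)],
   where [b = ln D]. *)
Lemma expn_le_expR_powR (R : realType) (q : nat) (gamma b t : R) :
  (0 < q)%N -> 0 < gamma -> 0 <= t ->
  t ^+ q.*2 <= expR (q%:R * (2 / gamma * ln q%:R - b)) *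
    expR (2 / gamma * expR (gamma / 2 * b) * t `^ gamma).
Proof.
move=> q0 g0; rewrite le_eqVlt => /predU1P[<-|t0].
  by rewrite expr0n gtn_eqF ?double_gt0//= mulr_ge0 ?expR_ge0.
have qR : 0 < q%:R :> R by rewrite ltr0n.
rewrite -[X in X ^+ _](@lnK _ t)// -expRM_natl -expRD ler_expR.
rewrite /powR gt_eqF//.
have := expR_ge1Dx (gamma * ln t + gamma / 2 * b - ln q%:R).
rewrite !expRD expRN lnK//; set e := _ * expR _ / _ => le_e.
have -> : 2 / gamma * expR (gamma / 2 * b) * expR (gamma * ln t) =
    2 / gamma * (q%:R * e).
  by rewrite /e; field; rewrite !gt_eqF.
rewrite -muln2 natrM.
have -> : q%:R * 2 * ln t = q%:R * (2 / gamma * ln q%:R - b) +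
    2 / gamma * (q%:R * (gamma * ln t + gamma / 2 * b - ln q%:R)).
  by field; rewrite gt_eqF.
rewrite lerD2l ler_wpM2l ?divr_ge0 ?(ltW g0)// ler_wpM2l ?(ltW qR)//.
by apply: le_trans le_e; rewrite lerDr.
Qed.

(** With [y = 2 ^ (N * eta)], [e ^ y] exceeds [y ^ (k + 1) / (k + 1)!], which for large [k] is at
    least a constant times [4 ^ N]; hence [u N] is dominated by a geometric series of ratio 1/2. *)
Lemma exponential_series_lty (R : realType) (eta C : R) (u : nat -> \bar R) :
  0 < eta -> 0 <= C -> (forall N, 0 <= u N)%E ->
  (forall N, u N <= (C * (2 ^+ N * expR (- 2 `^ (N%:R * eta))))%:E)%E ->
  (\sum_(1 <= N <oo) u N < +oo)%E.
Proof.
move=> eta0 C0 u0 uC; rewrite -nneseries_addn//.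
(* Chosen so that [(k + 1) * eta >= 2], that is [y ^ (k + 1) >= 4 ^ M] below. *)
pose k := Num.truncn (2 / eta).
have k2 : 2 <= k.+1%:R * eta.
  by rewrite -ler_pdivrMr// ltW// truncnS_gt.
pose C' : R := C * k.+1`!%:R.
have uC' N : (u (N + 1)%N <= (C' / (2 ^ N.+1)%:R)%:E)%E.
  rewrite addn1 (le_trans (uC _))// lee_fin /C' -!mulrA ler_wpM2l//.
  set M := N.+1; set y := 2 `^ (M%:R * eta).
  have y0 : 0 < y by exact: powR_gt0.
  have yk : 4 ^+ M <= y ^+ k.+1.
    rewrite -powR_mulrn ?powR_ge0// -powRrM (_ : 4 = 2 ^+ 2)//; last first.
      by rewrite -natrX.
    rewrite -exprM -powR_mulrn// ler_powR ?ler1n// natrM mulrC -mulrA.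
    by rewrite ler_wpM2l// mulrC.
  have yE : y ^+ k.+1 / k.+1`!%:R <= expR y.
    by apply: le_trans (expR_ge1Dxn k (ltW y0)); rewrite lerDr.
  rewrite expRN natrX ler_pdivrMr ?expR_gt0// mulrAC ler_pdivlMr ?exprn_gt0//.
  rewrite -exprMn -[X in X ^+ _]/(2 * 2) (_ : 2 * 2 = 4); last by rewrite -natrM.
  rewrite (le_trans yk)// mulrC -ler_pdivrMr// ltr0n fact_gt0//.
apply: (@le_lt_trans _ _ (\sum_(i <oo) (C' / (2 ^ i.+1)%:R)%:E)%E).
  by apply: lee_nneseries => // N _; exact: uC'.
rewrite (le_lt_trans (epsilon_trick0 _ _))// ?ltry//.
by rewrite mulr_ge0.
Qed.

(* [b] is the logarithm of the constant D, chosen so that all the terms of order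
   [q] cancel except [- 2 * q]. *)
Lemma shared_families_tail_le (R : realType) (r i n N q : nat)
    (alpha gamma eps : R) (s := (2 * r - i)%N)
    (y := 2 `^ (N%:R * (alpha - (r%:R - i%:R / 2)) *
                 (2 * gamma / (i%:R * gamma + 2))))
    (b := (i%:R + 2 / gamma) * ln 2 + s%:R + i%:R * ln s%:R - 2 * ln eps + 2) :
  (0 < r)%N -> (i <= r)%N -> 0 < gamma -> 0 < eps ->
  r%:R - i%:R / 2 < alpha -> (n <= 2 ^ N)%N -> q = (Num.truncn y).+1 ->
  #|shared_families q.*2 r i n|%:R * expR (q%:R * (2 / gamma * ln q%:R - b)) /
    (eps * 2 `^ (N%:R * alpha)) ^+ q.*2 <= expR (- (2 * y)).
Proof.
move=> r0 ir g0 eps0 halpha nN qE.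
have s0 : (0 < s)%N by rewrite /s; lia.
have q0 : (0 < q)%N by rewrite qE.
have sR : 0 < s%:R :> R by rewrite ltr0n.
have qR : 0 < q%:R :> R by rewrite ltr0n.
have ig : 0 < i%:R * gamma + 2 by rewrite ltr_wpDl// mulr_ge0// ltW.
have y0 : 0 < y by exact: powR_gt0.
have y1 : 1 <= y.
  rewrite -(powRr0 2) ler_powR ?ler1n// //.
  rewrite mulr_ge0 ?divr_ge0 ?mulr_ge0 ?(ltW ig) ?(ltW g0)//.
  by rewrite subr_ge0 ltW.
(* Since [y >= 1], [q] lies between [y] and [2 * y]: the lower bound turns [exp (- 2 q)] into
   [exp (- 2 y)], the upper one controls [ln q]. *)
have yq : y <= q%:R by rewrite qE ltW// truncnS_gt.
have q2y : q%:R <= 2 * y.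
  rewrite qE -natr1 mulr_natl mulr2n lerD// truncn_le.
  exact: ltW.
have lnq : ln q%:R <= ln 2 + N%:R * (alpha - (r%:R - i%:R / 2)) *
    (2 * gamma / (i%:R * gamma + 2)) * ln 2.
  by rewrite -ln_powR -/y -lnM ?posrE// ler_ln ?posrE// mulr_gt0.
have cardE : #|shared_families q.*2 r i n|%:R <=
    expR (q%:R * (s%:R + s%:R * (N%:R * ln 2) + i%:R * (ln q%:R + ln s%:R))) :> R.
  apply: le_trans (card_shared_families_le _ _ _ ir) _; rewrite -/s.
  rewrite mulrDr mulrDr !expRD -mulrA ler_pM ?mulr_ge0 ?exprn_ge0 ?expR_ge0//.
    by rewrite natrM.
  rewrite ler_pM ?exprn_ge0//.
    rewrite mulrA -natrM expRM_natl expRM_natl lnK ?posrE//.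
    by rewrite lerXn2r ?nnegrE ?exprn_ge0// -natrX ler_nat.
  rewrite mulrA -natrM expRM_natl -lnM ?posrE// lnK ?posrE ?mulr_gt0//.
  by rewrite natrM.
have tE : ((eps * 2 `^ (N%:R * alpha)) ^+ q.*2)^-1 =
    expR (- (q%:R * 2 * (ln eps + N%:R * alpha * ln 2))).
  rewrite expRN -natrM muln2 expRM_natl expRD lnK ?posrE//.
  by rewrite /powR pnatr_eq0.
rewrite tE -mulrA -expRD.
apply: le_trans (ler_wpM2r (expR_ge0 _) cardE) _.
rewrite -expRD ler_expR.
(* All factors are now exponentials of multiples of [q]; it remains to bound the coefficient of [q]
   by [-2]. *)
apply: (@le_trans _ _ (q%:R * (- 2))); last first.
  by rewrite mulrN lerN2 mulrC ler_wpM2r.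
rewrite [leLHS](_ : _ = q%:R * (s%:R + s%:R * (N%:R * ln 2) +
    i%:R * (ln q%:R + ln s%:R) + (2 / gamma * ln q%:R - b) -
    2 * (ln eps + N%:R * alpha * ln 2))); last by ring.
rewrite ler_wpM2l ?ler0n//.
have c0 : 0 <= i%:R + 2 / gamma by rewrite addr_ge0// divr_ge0// ltW.
have := ler_wpM2l c0 lnq.
(* The exponent [2 gamma / (i gamma + 2)] is the one whose product with [i + 2 / gamma] is 2; the
   terms in [N] then cancel against [s - 2 alpha = - 2 (alpha - (r - i / 2))]. *)
have -> : (i%:R + 2 / gamma) * (ln 2 + N%:R * (alpha - (r%:R - i%:R / 2)) *
    (2 * gamma / (i%:R * gamma + 2)) * ln 2) = (i%:R + 2 / gamma) * ln 2 +
    2 * (N%:R * (alpha - (r%:R - i%:R / 2)) * ln 2).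
  by field; rewrite !gt_eqF.
rewrite /b; move: (ln s%:R) => ls.
have -> : s%:R = 2 * r%:R - i%:R :> R by rewrite natrB ?natrM//; lia.
move: (ln 2) (ln q%:R) (ln eps) (gamma^-1) => l2 lq le g1 H.
rewrite [leLHS](_ : _ = -2 + ((i%:R + 2 * g1) * lq - ((i%:R + 2 * g1) * l2 +
    2 * (N%:R * (alpha - (r%:R - i%:R / 2)) * l2)))); last by field.
by rewrite gerDl subr_le0.
Qed.

(** * Orthogonality of degenerate kernels *)

Lemma measurable_lt_set d (T : measurableType d) (R : realType) (f : T -> R)
    (t : R) : measurable_fun [set: T] f -> measurable [set w | t < f w].
Proof.
move=> mf; rewrite (_ : [set w | _] = setT `&` f @^-1` `]t, +oo[%classic).
  by apply: mf => //; exact: measurable_itv.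
by apply/seteqP; split => w /=; rewrite in_itv /= andbT => // -[].
Qed.

(** * Orthogonality to the functions of a random element [V] *)

Section integral_mul_comp.
Import HBNNSimple.
Context d d' (T : measurableType d) (S : measurableType d') (R : realType).
Variables (mu : {measure set T -> \bar R}) (psi : T -> R) (V : T -> S).
Hypotheses (mV : measurable_fun [set: T] V)
  (ipsi : mu.-integrable [set: T] (EFin \o psi)).
Hypothesis psi0 : forall A : set S, measurable A ->
  (\int[mu]_(w in V @^-1` A) (psi w)%:E = 0)%E.

Lemma integral_mul_nnsfun_comp_eq0 (f : {nnsfun S >-> R}) :
  (\int[mu]_w (psi w * f (V w))%:E = 0)%E.
Proof.
have mA y : measurable (V @^-1` (f @^-1` [set y])).
  by rewrite -[X in measurable X]setTI; apply: mV => //; exact: measurable_sfunP.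
have eA y (w : T) : (psi w * (y * \1_(f @^-1` [set y]) (V w)))%:E =
    (y%:E * ((EFin \o psi) \_ (V @^-1` (f @^-1` [set y]))) w)%E.
  rewrite epatch_indic /= -!EFinM; congr EFin.
  by rewrite mulrCA; congr (_ * (_ * _)).
have iA y : mu.-integrable [set: T]
    ((EFin \o psi) \_ (V @^-1` (f @^-1` [set y]))).
  by apply/(integrable_mkcond _ (mA y)).1; exact: (integrableS measurableT).
under eq_integral.
  move=> w _; rewrite fimfunE fsbig_finite//= mulr_sumr -sumEFin.
  under eq_bigr do rewrite eA.
  over.
rewrite /= integral_sum//; last by move=> y; exact: integrableZl.
apply: big1 => y _; rewrite integralZl// -integral_mkcond/=.
by rewrite psi0 ?mule0//; exact: measurable_sfunP.
Qed.

(** Simple functions increasing to [phi] reduce this to the previous lemma; dominated convergence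
    applies with dominating function [|psi * phi(V)|]. *)
Lemma integral_mul_ge0_comp_eq0 (phi : S -> R) :
  measurable_fun [set: S] phi -> (forall x, 0 <= phi x) ->
  mu.-integrable [set: T] (EFin \o (psi \* (phi \o V))) ->
  (\int[mu]_w (psi w * phi (V w))%:E = 0)%E.
Proof.
move=> mphi phi0 iphi.
have mphi' : measurable_fun [set: S] (EFin \o phi) by exact/measurable_EFinP.
pose f_ := nnsfun_approx measurableT mphi'.
have le_f n x : f_ n x <= phi x.
  by rewrite -lee_fin /f_ nnsfun_approxE; apply: le_approx => // *; rewrite lee_fin.
have mpsi : measurable_fun [set: T] psi.
  by apply/measurable_EFinP; exact: measurable_int ipsi.
have [] := @dominated_convergence _ _ _ mu setT measurableT
  (fun n w => (psi w * f_ n (V w))%:E) (fun w => (psi w * phi (V w))%:E)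
  (abse \o (EFin \o (psi \* (phi \o V)))).
- move=> n; apply/measurable_EFinP; apply: measurable_funM => //.
  by apply: measurableT_comp.
- exact: measurable_int iphi.
- apply: aeW => w _; under eq_fun do rewrite EFinM.
  rewrite EFinM; apply: cvgeZl => //.
  by apply: (cvg_nnsfun_approx measurableT mphi') => //= x _; rewrite lee_fin.
- exact: integrable_abse.
- apply: aeW => w n _ /=; rewrite lee_fin !normrM ler_wpM2l//.
  by rewrite !ger0_norm.
move=> _ _ /cvg_lim <- //.
rewrite (_ : (fun n => _) = fun _ => 0%E); first by rewrite lim_cst.
by apply/funext => n; exact: integral_mul_nnsfun_comp_eq0.
Qed.

Lemma integral_mul_comp_eq0 (phi : S -> R) :
  measurable_fun [set: S] phi ->
  mu.-integrable [set: T] (EFin \o (psi \* (phi \o V))) ->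
  (\int[mu]_w (psi w * phi (V w))%:E = 0)%E.
Proof.
move=> mphi iphi.
have mpsi : measurable_fun [set: T] psi.
  by apply/measurable_EFinP; exact: measurable_int ipsi.
have isub (chi : S -> R) : measurable_fun [set: S] chi ->
    (forall x, `|chi x| <= `|phi x|) ->
    mu.-integrable [set: T] (EFin \o (psi \* (chi \o V))).
  move=> mchi lechi; apply: le_integrable iphi => //.
    apply/measurable_EFinP; apply: measurable_funM => //.
    exact: measurableT_comp.
  by move=> w _ /=; rewrite lee_fin !normrM ler_wpM2l.
have mp : measurable_fun [set: S] phi^\+ by exact: measurable_funrpos.
have mn : measurable_fun [set: S] phi^\- by exact: measurable_funrneg.
have phiE x : phi x = phi^\+ x - phi^\- x by rewrite -[in LHS](funrposBneg phi).
have absE x : `|phi x| = phi^\+ x + phi^\- x.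
  by rewrite -/((Num.norm \o phi) x) -funrposDneg.
have ip : mu.-integrable [set: T] (EFin \o (psi \* (phi^\+ \o V))).
  apply: isub => // x; rewrite absE ger0_norm ?funrpos_ge0//.
  by rewrite lerDl funrneg_ge0.
have im : mu.-integrable [set: T] (EFin \o (psi \* (phi^\- \o V))).
  apply: isub => // x; rewrite absE ger0_norm ?funrneg_ge0//.
  by rewrite lerDr funrpos_ge0.
under eq_integral do rewrite phiE mulrBr EFinB.
rewrite integralB_EFin//.
by rewrite !integral_mul_ge0_comp_eq0 ?sube0// => x;
  rewrite ?funrpos_ge0 ?funrneg_ge0.
Qed.

End integral_mul_comp.

(** * Measurable rectangles in a finite power *)

Section tuple_rectangles.
Context d (S : measurableType d) (r : nat).

Definition tuple_rectangle (B : 'I_r -> set S) : set (r.-tuple S) :=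
  [set x | forall k, B k (tnth x k)].

Definition measurable_rectangles : set (set (r.-tuple S)) :=
  [set tuple_rectangle B | B in [set B | forall k, measurable (B k)]].

Lemma measurable_tuple_rectangle (B : 'I_r -> set S) :
  (forall k, measurable (B k)) -> measurable (tuple_rectangle B).
Proof.
move=> mB; rewrite (_ : tuple_rectangle B = \bigcap_(k in [set` index_enum 'I_r])
    ((fun x : r.-tuple S => tnth x k) @^-1` B k)).
  rewrite bigcap_seq; apply: bigsetI_measurable => k _.
  by rewrite -[X in measurable X]setTI; exact: measurable_tnth.
apply/seteqP; split => x Bx k //; first by move=> _; exact: Bx.
by apply: Bx; rewrite /= mem_index_enum.
Qed.

(** A generating set constrains one coordinate and is a rectangle with full sides elsewhere.
    Rectangles thus form the pi-system on which measures are compared and Dynkin induction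
    starts. *)
Lemma measurable_rectanglesE :
  @measurable _ (r.-tuple S) = <<s measurable_rectangles >>.
Proof.
apply/seteqP; split; last first.
  apply: smallest_sub; first exact: sigma_algebra_measurable.
  by move=> _ [B mB <-]; exact: measurable_tuple_rectangle.
apply: smallest_sub; first exact: smallest_sigma_algebra.
rewrite -bigcup_seq => A [k _ [C mC <-]].
apply: sub_sigma_algebra; exists (fun j => if j == k then C else setT).
  by move=> j; case: ifP.
apply/seteqP; split => x /=.
  by move=> /(_ k); rewrite eqxx; split.
by move=> [_ Cx] j; case: eqP => [->|].
Qed.

Lemma setI_closed_rectangles : setI_closed measurable_rectangles.
Proof.
move=> _ _ [A mA <-] [B mB <-]; exists (fun k => A k `&` B k).
  by move=> k; exact: measurableI.
apply/seteqP; split => x /=; first by move=> AB; split => k; case: (AB k).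
by move=> [Ax Bx] k; split.
Qed.

Lemma measurable_rectangles_setT : measurable_rectangles setT.
Proof. by exists (fun=> setT) => //; apply/seteqP; split. Qed.

End tuple_rectangles.

(** The permutation enumerates the elements of [Q] first and the others afterwards. *)
Lemma perm_front (r m : nat) (Q : pred 'I_r) : (#|Q| <= m)%N ->
  exists s : 'S_r, forall k, Q (s k) -> (k < m)%N.
Proof.
move=> Qm; pose e := enum Q ++ enum (predC Q).
have se : size e = r by rewrite size_cat -!cardE cardC card_ord.
have ue : uniq e.
  rewrite cat_uniq !enum_uniq andbT/=; apply/hasPn => x.
  by rewrite !mem_enum.
case: r => [|r] in Q Qm e se ue *; first by exists 1%g => -[].
have inj : injective (fun k : 'I_r.+1 => nth ord0 e k).
  by move=> x y /eqP; rewrite nth_uniq ?se// => /eqP/val_inj.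
exists (perm inj) => k; rewrite permE nth_cat -cardE; case: ltnP => kQ.
  by move=> _; exact: leq_trans kQ Qm.
have : nth ord0 (enum (predC Q)) (k - #|Q|) \in enum (predC Q).
  by rewrite mem_nth// -cardE ltn_subLR// cardC card_ord.
by rewrite mem_enum inE/= => /negbTE; rewrite /in_mem/= => ->.
Qed.

(** * Laws and independence of samples from an i.i.d. sequence *)

Section iid_samples.
Context d d' (T : measurableType d) (S : measurableType d') (R : realType).
Variables (P : probability T R) (X : nat -> {RV P >-> S}).

(** Repeated indices are allowed: injectivity of [f] is required only where the law of the sample or
    its independence is used. *)
Definition tuple_sample (n : nat) (f : 'I_n -> nat) (w : T) : n.-tuple S :=
  [tuple X (f k) w | k < n].

Lemma measurable_tuple_sample (n : nat) (f : 'I_n -> nat) :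
  measurable_fun [set: T] (tuple_sample f).
Proof.
apply/measurable_fun_tnthP => k.
rewrite (_ : _ \o _ = X (f k)); first exact: measurable_funP.
by apply/funext => w /=; rewrite tnth_mktuple.
Qed.

Definition cylinder (J : seq nat) (C : nat -> set S) : set T :=
  \bigcap_(j in [set` J]) X j @^-1` C j.

Lemma measurable_cylinder (J : seq nat) (C : nat -> set S) :
  (forall j, measurable (C j)) -> measurable (cylinder J C).
Proof.
move=> mC; rewrite /cylinder bigcap_seq; apply: bigsetI_measurable => j _.
exact: measurable_funPTI.
Qed.

Hypothesis hX : iid X.

Lemma prob_cylinder (J : seq nat) (C : nat -> set S) : uniq J ->
  (forall j, measurable (C j)) ->
  P (cylinder J C) = (\prod_(j <- J) P (X j @^-1` C j))%E.
Proof.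
move=> uJ mC; pose K : {fset nat} := [fset j in J]%fset.
have KJ : perm_eq K J.
  by apply: uniq_perm => // j; rewrite ?fset_uniq// inE.
rewrite -(perm_big _ KJ)/= -(proj1 hX)// /cylinder.
by congr (P _); apply/seteqP; split => w H j /= jJ; apply: H; rewrite /= inE in jJ *.
Qed.

(** The event is one cylinder over the distinct indices of [I] and [J], so mutual independence
    factors it and identical distribution replaces each [X (I k)] by [X 0]. *)
Lemma prob_sample_cylinder (r : nat) (I : 'I_r -> nat) (B : 'I_r -> set S)
    (J : seq nat) (C : nat -> set S) :
  injective I -> uniq J -> (forall k, I k \notin J) ->
  (forall k, measurable (B k)) -> (forall j, measurable (C j)) ->
  P (tuple_sample I @^-1` (tuple_rectangle B) `&` cylinder J C) =
  ((\prod_(k < r) distribution P (X 0) (B k)) * P (cylinder J C))%E.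
Proof.
move=> injI uJ IJ mB mC.
(* As [I] is injective, the intersection at [j = I k] is just [B k]; it avoids inverting [I]. *)
pose A j := if j \in J then C j else
  \bigcap_(k in [set k | I k = j]) B k.
have mA j : measurable (A j).
  rewrite /A; case: ifP => // _; apply: fin_bigcap_measurable => //.
have AI k : A (I k) = B k.
  rewrite /A (negbTE (IJ k)); apply/seteqP; split => x; first exact.
  by move=> Bx j /= /injI ->.
have -> : tuple_sample I @^-1` (tuple_rectangle B) `&` cylinder J C =
    cylinder ([seq I k | k <- index_enum 'I_r] ++ J) A.
  apply/seteqP; split => w /=.
    move=> [Bw Cw] j; rewrite /= mem_cat => /orP[/mapP[k _ ->]|jJ].
      by rewrite /= AI; have := Bw k; rewrite tnth_mktuple.
    by rewrite /= /A jJ; exact: Cw.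
  move=> Aw; split => [k|j /= jJ].
    rewrite tnth_mktuple -AI; apply: (Aw (I k)) => /=.
    by rewrite mem_cat map_f// mem_index_enum.
  have := Aw j; rewrite /= mem_cat jJ orbT => /(_ isT).
  by rewrite /A jJ.
rewrite prob_cylinder//; last first.
  rewrite cat_uniq uJ map_inj_uniq// index_enum_uniq/= andbT.
  by apply/hasPn => j jJ; apply/mapP => -[k _ jE]; move: (IJ k); rewrite -jE jJ.
rewrite prob_cylinder// big_cat big_map; congr (_ * _)%E.
  by apply: eq_bigr => k _; rewrite AI -(proj2 hX (I k)).
by apply: eq_big_seq => j jJ; rewrite /A jJ.
Qed.

(** The probability of a rectangle does not involve [I] (take [J] empty above), and rectangles
    determine the law. *)
Lemma tuple_sample_law (r : nat) (I I' : 'I_r -> nat) :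
  injective I -> injective I' -> forall A, measurable A ->
  P (tuple_sample I @^-1` A) = P (tuple_sample I' @^-1` A).
Proof.
move=> injI injI' A mA.
pose m K := pushforward P (@tuple_sample r K).
have mm K := measurable_tuple_sample K.
pose mf K : {mfun T >-> r.-tuple S} := HB.pack (@tuple_sample r K)
  (isMeasurableFun.Build _ _ _ _ _ (mm r K)).
apply: (measure_unique (@measurable_rectangles _ S r) (fun=> setT) _ _ _ _
  (distribution P (mf I)) (distribution P (mf I'))) => //.
- exact: measurable_rectanglesE.
- exact: setI_closed_rectangles.
- by move=> _; exact: measurable_rectangles_setT.
- by rewrite bigcup_const.
- move=> _ [B mB <-]; have cyl0 : cylinder [::] (fun=> setT) = setT.
    by apply/seteqP; split.
  have := @prob_sample_cylinder r I B [::] (fun=> setT).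
  have := @prob_sample_cylinder r I' B [::] (fun=> setT).
  by rewrite cyl0 !setIT => H' H; rewrite [LHS]H// [RHS]H'.
- by move=> _; rewrite (le_lt_trans (probability_le1 _ _))// ltry.
Qed.

(** As functions of [A], both sides are finite measures, a law under restricted [P] and a rescaled
    law, and they agree on rectangles. *)
Lemma tuple_sample_indep (r : nat) (I : 'I_r -> nat) (J : seq nat)
    (C : nat -> set S) :
  injective I -> uniq J -> (forall k, I k \notin J) ->
  (forall j, measurable (C j)) -> forall A, measurable A ->
  P (tuple_sample I @^-1` A `&` cylinder J C) =
  (P (tuple_sample I @^-1` A) * P (cylinder J C))%E.
Proof.
move=> injI uJ IJ mC A mA.
pose mf : {mfun T >-> r.-tuple S} := HB.pack (tuple_sample I)
  (isMeasurableFun.Build _ _ _ _ _ (measurable_tuple_sample I)).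
have mE := measurable_cylinder J mC.
have fE : P (cylinder J C) \is a fin_num by exact: fin_num_measure.
pose c : {nonneg R} := NngNum (fine_ge0 (measure_ge0 P (cylinder J C))).
have cE : P (cylinder J C) = (c%:num%:E)%E by rewrite /= fineK.
rewrite cE muleC.
apply: (measure_unique (@measurable_rectangles _ S r) (fun=> setT) _ _ _ _
  (pushforward (mrestr P mE) mf) (mscale c (distribution P mf))) => //.
- exact: measurable_rectanglesE.
- exact: setI_closed_rectangles.
- by move=> _; exact: measurable_rectangles_setT.
- by rewrite bigcup_const.
- move=> _ [B mB <-]; have cyl0 : cylinder [::] (fun=> setT) = setT.
    by apply/seteqP; split.
  have := @prob_sample_cylinder r I B [::] (fun=> setT) injI isT.
  rewrite cyl0 setIT probability_setT mule1 => H.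
  rewrite /mscale /= [X in _ = (_ * X)%E]H//.
  rewrite [LHS](prob_sample_cylinder injI uJ IJ mB mC) cE muleC//.
- move=> _; rewrite (le_lt_trans _ (ltry 1%R))//.
  apply: (@probability_le1 _ _ _ P); apply: measurableI => //.
  exact: measurable_funPTI.
Qed.

(** By independence the centred indicator [\1_E - P E] integrates to zero over every event of the
    sample, so it is orthogonal to [psi] of the sample. *)
Lemma integral_tuple_sample_cylinder (r : nat) (I : 'I_r -> nat) (J : seq nat)
    (C : nat -> set S) (psi : r.-tuple S -> R) :
  injective I -> uniq J -> (forall k, I k \notin J) ->
  (forall j, measurable (C j)) -> measurable_fun [set: r.-tuple S] psi ->
  P.-integrable [set: T] (EFin \o (psi \o tuple_sample I)) ->
  (\int[P]_(w in cylinder J C) (psi (tuple_sample I w))%:E =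
   P (cylinder J C) * \int[P]_w (psi (tuple_sample I w))%:E)%E.
Proof.
move=> injI uJ IJ mC mpsi ipsi.
set E := cylinder J C; have mE : measurable E := measurable_cylinder J mC.
have mI := measurable_tuple_sample I.
pose c : R := fine (P E).
have cE : P E = c%:E by rewrite fineK// fin_num_measure.
have i1E : P.-integrable [set: T] (EFin \o \1_E) by exact: integrable_indic.
have ic : P.-integrable [set: T] (EFin \o (cst c : T -> R)).
  by apply: finite_measure_integrable_cst.
have iE : P.-integrable [set: T]
    (EFin \o (\1_E \* (psi \o tuple_sample I))).
  have := (integrable_mkcond (EFin \o (psi \o tuple_sample I)) mE).1
    (integrableS measurableT mE (@subsetT _ _) ipsi).
  rewrite epatch_indic; apply: eq_integrable => // w _.
  by rewrite /= -EFinM mulrC.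
have icpsi : P.-integrable [set: T]
    (EFin \o (fun w => c * psi (tuple_sample I w))).
  exact: (integrableZl measurableT c ipsi).
have := @integral_mul_comp_eq0 _ _ _ _ _ P (fun w => \1_E w - c)
  (tuple_sample I) mI.
move=> /(_ _ _ psi mpsi); rewrite cE => H.
have : (\int[P]_w ((\1_E w - c) * psi (tuple_sample I w))%:E = 0)%E.
  apply: H.
  - exact: (integrableB measurableT i1E ic).
  - move=> A mA; have mIA : measurable (tuple_sample I @^-1` A).
      by rewrite -[X in measurable X]setTI; exact: mI.
    rewrite integralB_EFin//; [|exact: integrableS i1E|exact: integrableS ic].
    rewrite integral_indic// integral_cst//.
    rewrite [X in (X - _)%E](_ : _ = c%:E * P (tuple_sample I @^-1` A))%E.
      by rewrite subee// fin_numM// fin_num_measure.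
    by rewrite setIC muleC -cE; exact: tuple_sample_indep.
  - apply: eq_integrable (integrableB measurableT iE icpsi) => // w _.
    by rewrite /= mulrBl EFinB.
under eq_integral do rewrite mulrBl EFinB.
rewrite integralB_EFin//.
under [X in (_ - X)%E]eq_integral do rewrite EFinM.
rewrite integralZl// => /eqP; rewrite sube_eq ?add0e; last 2 first.
- exact: integrable_fin_num iE.
- by rewrite fin_num_adde_defr.
move=> /eqP <-; rewrite [LHS]integral_mkcond epatch_indic.
by apply: eq_integral => w _; rewrite /= -EFinM mulrC.
Qed.

Lemma ge0_integral_tuple_sample (r : nat) (I I' : 'I_r -> nat)
    (phi : r.-tuple S -> \bar R) : injective I -> injective I' ->
  measurable_fun [set: r.-tuple S] phi -> (forall x, 0 <= phi x)%E ->
  (\int[P]_w phi (tuple_sample I w) = \int[P]_w phi (tuple_sample I' w))%E.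
Proof.
move=> injI injI' mphi phi0.
have E K : (\int[P]_w phi (tuple_sample K w) =
    \int[pushforward P (tuple_sample K)]_x phi x)%E.
  by rewrite ge0_integral_pushforward//; exact: measurable_tuple_sample.
rewrite !E.
pose mf K : {mfun T >-> r.-tuple S} := HB.pack (@tuple_sample r K)
  (isMeasurableFun.Build _ _ _ _ _ (measurable_tuple_sample K)).
apply: (@eq_measure_integral _ _ _ _ (distribution P (mf I'))
  (distribution P (mf I))) => A mA _.
exact: tuple_sample_law.
Qed.

Lemma integrable_tuple_sample (r : nat) (I I' : 'I_r -> nat)
    (phi : r.-tuple S -> R) : injective I -> injective I' ->
  measurable_fun [set: r.-tuple S] phi ->
  P.-integrable [set: T] (EFin \o (phi \o tuple_sample I)) ->
  P.-integrable [set: T] (EFin \o (phi \o tuple_sample I')).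
Proof.
move=> injI injI' mphi /integrableP[_ iphi]; apply/integrableP; split.
  apply/measurable_EFinP; apply: measurableT_comp => //.
  exact: measurable_tuple_sample.
rewrite (le_lt_trans _ iphi)//.
rewrite (@ge0_integral_tuple_sample _ I' I (fun x => `|(phi x)%:E|%E))//.
by apply: measurableT_comp => //; exact/measurable_EFinP.
Qed.

Lemma integral_tuple_sample (r : nat) (I I' : 'I_r -> nat)
    (phi : r.-tuple S -> R) : injective I -> injective I' ->
  measurable_fun [set: r.-tuple S] phi ->
  (\int[P]_w (phi (tuple_sample I w))%:E =
   \int[P]_w (phi (tuple_sample I' w))%:E)%E.
Proof.
move=> injI injI' mphi.
have mphi' : measurable_fun [set: r.-tuple S] (EFin \o phi).
  exact/measurable_EFinP.
have E K : (\int[P]_w (phi (tuple_sample K w))%:E =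
    \int[P]_w (EFin \o phi)^\+ (@tuple_sample r K w) -
    \int[P]_w (EFin \o phi)^\- (tuple_sample K w))%E.
  rewrite [LHS]integralE; congr (_ - _)%E; apply: eq_integral => w _.
    by rewrite !funeposE.
  by rewrite !funenegE.
rewrite !E (ge0_integral_tuple_sample injI injI' (measurable_funepos mphi'))//.
by rewrite (ge0_integral_tuple_sample injI injI' (measurable_funeneg mphi')).
Qed.

Lemma natural_filtration_rectangle (r m : nat) (B : 'I_r -> set S) :
  (forall k, measurable (B k)) -> (forall k : 'I_r, (m <= k)%N -> B k = setT) ->
  natural_filtration X m
    (tuple_sample (fun k : 'I_r => k : nat) @^-1` tuple_rectangle B).
Proof.
(* [D j] is [B j] for [j < r] and, as an empty intersection, the whole space for [j >= r]; so [m]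
   may exceed [r]. *)
move=> mB BT; pose D j := \bigcap_(k in [set k : 'I_r | k = j :> nat]) B k.
have mD j : measurable (D j) by exact: fin_bigcap_measurable.
rewrite (_ : _ @^-1` _ = \bigcap_(k in [set` index_enum 'I_m]) X k @^-1` D k).
  rewrite bigcap_seq /natural_filtration /g_sigma_preimage.
  set G := \big[_/_]_(_ < _) _.
  apply: (@bigsetI_measurable _ (g_sigma_algebraType G)) => k _.
  apply: sub_sigma_algebra; rewrite /G -bigcup_seq.
  exists k; rewrite /= ?mem_index_enum//.
  by exists (D k); rewrite ?setTI.
apply/seteqP; split => w /=.
  move=> Bw k _ l /= <-; have := Bw l; rewrite tnth_mktuple.
  by [].
move=> Dw k; rewrite tnth_mktuple; have [km|mk] := ltnP k m; last by rewrite BT.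
have := Dw (Ordinal km); rewrite /= mem_index_enum => /(_ isT); exact.
Qed.

(** * Degenerate kernels against samples sharing few indices *)

Section degenerate.
Variables (r m : nat) (h : r.-tuple S -> R).
Hypotheses (mh : measurable_fun [set: r.-tuple S] h)
  (hsym : symmetric_kernel h)
  (iY : P.-integrable [set: T] (EFin \o kernel_sample h X)).
Hypothesis Y0 : forall A, natural_filtration X m A ->
  (\int[P]_(w in A) (kernel_sample h X w)%:E = 0)%E.

(* By symmetry the indices of [I] that occur in [f] may be moved to the first [m]
   places. The other indices in [f] are independent of the sample [I] and factor
   out, and what remains is an integral of Y over an event of F_m. *)
Lemma integral_degenerate_rectangle (n : nat) (I : 'I_r -> nat)
    (f : 'I_n -> nat) (B : 'I_n -> set S) :
  injective I -> (#|[pred k | I k \in codom f]| <= m)%N ->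
  (forall k, measurable (B k)) ->
  (\int[P]_(w in tuple_sample f @^-1` tuple_rectangle B)
    (h (tuple_sample I w))%:E = 0)%E.
Proof.
move=> injI /perm_front[s sP] mB; pose I' := I \o s.
have injI' : injective I' by apply: inj_comp => //; exact: perm_inj.
have hI' w : h (tuple_sample I w) = h (tuple_sample I' w).
  rewrite -[LHS](hsym s); congr h.
  by apply: eq_from_tnth => k; rewrite !tnth_mktuple.
under eq_integral do rewrite hI'.
(* All constraints that the event puts on [X j]; several coordinates may carry the same index, and
   an index outside [f] is left free. *)
pose C j := \bigcap_(k in [set k | f k = j]) B k.
have mC j : measurable (C j) by exact: fin_bigcap_measurable.
have CT j : j \notin codom f -> C j = setT.
  move=> jf; apply/seteqP; split => // x _ k /= fk.
  by move: jf; rewrite -fk codom_f.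
pose J := [seq j <- undup (codom f) | j \notin codom I'].
pose D := tuple_rectangle (C \o I').
have mD : measurable D by apply: measurable_tuple_rectangle => k; exact: mC.
have -> : tuple_sample f @^-1` tuple_rectangle B =
    cylinder J C `&` tuple_sample I' @^-1` D.
  apply/seteqP; split => w /=.
    move=> Bw; have Cw j : C j (X j w).
      by move=> k /= <-; have := Bw k; rewrite tnth_mktuple.
    by split => [j _|k]; rewrite ?tnth_mktuple; exact: Cw.
  move=> [Cw Dw] k; rewrite tnth_mktuple.
  suff : C (f k) (X (f k) w) by exact.
  have [/codomP[l fkl]|fkI] := boolP (f k \in codom I').
    by have := Dw l; rewrite tnth_mktuple /= -fkl.
  by apply: Cw; rewrite /= mem_filter fkI mem_undup codom_f.
pose psi x := h x * \1_D x.
have mpsi : measurable_fun [set: r.-tuple S] psi by exact: measurable_funM.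
pose id_r (k : 'I_r) : nat := k.
have inj_id : injective id_r by exact: ord_inj.
have ihid : P.-integrable [set: T] (EFin \o (psi \o tuple_sample id_r)).
  apply: le_integrable iY => //.
    apply/measurable_EFinP; apply: measurableT_comp => //.
    exact: measurable_tuple_sample.
  move=> w _ /=; rewrite lee_fin normrM ler_piMr// indicE.
  by case: (_ \in _); rewrite ?normr1 ?normr0.
have ipsi : P.-integrable [set: T] (EFin \o (psi \o tuple_sample I')).
  exact: integrable_tuple_sample ihid.
have patchE K : (\int[P]_w (psi (tuple_sample K w))%:E =
    \int[P]_(w in tuple_sample K @^-1` D) (h (tuple_sample K w))%:E)%E.
  rewrite [RHS]integral_mkcond epatch_indic.
  by apply: eq_integral => w _; rewrite /= -EFinM.
rewrite integral_mkcondr epatch_indic.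
transitivity (\int[P]_(w in cylinder J C) (psi (tuple_sample I' w))%:E)%E.
  by apply: eq_integral => w _; rewrite /= -EFinM.
rewrite integral_tuple_sample_cylinder//; last 2 first.
- by rewrite filter_uniq// undup_uniq.
- by move=> k; rewrite mem_filter codom_f.
rewrite (integral_tuple_sample injI' inj_id)// patchE Y0 ?mule0//.
(* By the choice of [s], positions [k >= m] carry indices outside [f], hence are unconstrained and
   the event lies in [F_m]. *)
apply: natural_filtration_rectangle => k; first exact: mC.
move=> mk; apply: CT; apply: contraL mk => /sP.
by rewrite -ltnNge.
Qed.

(** The sets [A] with vanishing integral form a Dynkin system, and it contains the rectangles. *)
Lemma integral_degenerate_preimage (n : nat) (I : 'I_r -> nat)
    (f : 'I_n -> nat) (A : set (n.-tuple S)) :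
  injective I -> (#|[pred k | I k \in codom f]| <= m)%N -> measurable A ->
  (\int[P]_(w in tuple_sample f @^-1` A) (h (tuple_sample I w))%:E = 0)%E.
Proof.
move=> injI fm mA.
have mf : measurable_fun [set: T] (tuple_sample f).
  exact: measurable_tuple_sample.
have mfA B : measurable B -> measurable (tuple_sample f @^-1` B).
  by move=> mB; rewrite -[X in measurable X]setTI; exact: mf.
have ih : P.-integrable [set: T] (EFin \o (h \o tuple_sample I)).
  by apply: (@integrable_tuple_sample _ (fun k : 'I_r => k : nat)) => //;
    exact: ord_inj.
have rect0 B : measurable_rectangles B ->
    (\int[P]_(w in tuple_sample f @^-1` B) (h (tuple_sample I w))%:E = 0)%E.
  by move=> [B' mB' <-]; exact: integral_degenerate_rectangle.
have allT := rect0 _ (measurable_rectangles_setT S n).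
move: mA; rewrite measurable_rectanglesE; move: A; apply: dynkin_induction.
- exact: measurable_rectanglesE.
- exact: setI_closed_rectangles.
- exact: allT.
- exact: rect0.
- move=> B mB B0; have := allT.
  rewrite preimage_setT -(setvU (tuple_sample f @^-1` B)) integral_setU//.
  + by rewrite preimage_setC B0 adde0.
  + by apply: measurableC; exact: mfA.
  + exact: mfA.
  + apply: measurable_funTS.
    by case/integrableP : ih.
  + by apply/disj_set2P; rewrite setICl.
- move=> F mF tF F0; rewrite preimage_bigcup integral_bigcup.
  + by apply: eseries0 => k _ _; exact: F0.
  + by move=> j k _ _ [w [Fj Fk]]; apply: (tF j k) => //; exists (tuple_sample f w).
  + by move=> k; exact: mfA.
  + apply: integrableS ih => //; apply: bigcup_measurable => k _; exact: mfA.
Qed.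

Lemma integral_degenerate (n : nat) (I : 'I_r -> nat) (f : 'I_n -> nat)
    (phi : n.-tuple S -> R) :
  injective I -> (#|[pred k | I k \in codom f]| <= m)%N ->
  measurable_fun [set: n.-tuple S] phi ->
  P.-integrable [set: T]
    (EFin \o ((h \o tuple_sample I) \* (phi \o tuple_sample f))) ->
  (\int[P]_w (h (tuple_sample I w) * phi (tuple_sample f w))%:E = 0)%E.
Proof.
move=> injI fm mphi iphi.
apply: (@integral_mul_comp_eq0 _ _ _ _ _ P (h \o tuple_sample I)) => //.
- exact: measurable_tuple_sample.
- by apply: (@integrable_tuple_sample _ (fun k : 'I_r => k : nat)) => //;
    exact: ord_inj.
- by move=> A mA; exact: integral_degenerate_preimage.
Qed.

(** * Even moments and tails of the U-statistic *)

Section moments.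
Variables (q : nat) (M : R).
Hypotheses (q_gt0 : (0 < q)%N) (r_gt0 : (0 < r)%N)
  (iYq : P.-integrable [set: T]
    (EFin \o (fun w => `|kernel_sample h X w| ^+ q.*2)))
  (YqM : (\int[P]_w (`|kernel_sample h X w| ^+ q.*2)%:E = M%:E)%E).
Variable n : nat.

(** Extended by 0 to tuples that are not increasing, so that the U-statistic is a sum over all
    tuples and its powers expand over all families. *)
Let term (t : r.-tuple 'I_n) : T -> R :=
  if sorted ltn [seq val j | j <- t]
  then h \o tuple_sample (fun k => tnth t k) else cst 0.

Let p_gt0 : (0 < q.*2)%N. Proof. by rewrite double_gt0. Qed.

Let injective_sorted (t : r.-tuple 'I_n) :
  sorted ltn [seq val j | j <- t] -> injective (fun k => tnth t k : nat).
Proof.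
move=> /(sorted_uniq ltn_trans ltnn)/map_uniq/tuple_uniqP injt.
by move=> j k /val_inj/injt.
Qed.

Let measurable_term t : measurable_fun [set: T] (term t).
Proof.
rewrite /term; case: ifP => _ //.
apply: measurableT_comp => //; exact: measurable_tuple_sample.
Qed.

Let mhp : measurable_fun [set: r.-tuple S] (fun x => `|h x| ^+ q.*2).
Proof. by apply: measurable_funX; exact: measurableT_comp. Qed.

Let integrable_term t :
  P.-integrable [set: T] (EFin \o (fun w => `|term t w| ^+ q.*2)).
Proof.
rewrite /term; case: ifP => [/injective_sorted injt|_].
  apply: (@integrable_tuple_sample _ (fun k : 'I_r => k : nat) _
    (fun x => `|h x| ^+ q.*2)) => //; exact: ord_inj.
rewrite (_ : _ \o _ = cst 0%E); first exact: integrable0.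
by apply/funext => w /=; rewrite normr0 expr0n gtn_eqF.
Qed.

Let integral_term t : (\int[P]_w (`|term t w| ^+ q.*2)%:E <= M%:E)%E.
Proof.
rewrite /term; case: ifP => [/injective_sorted injt|_].
  rewrite -YqM (@integral_tuple_sample _ _ (fun k : 'I_r => k : nat)
    (fun x => `|h x| ^+ q.*2))//; exact: ord_inj.
rewrite integral0_eq.
  by rewrite -YqM; apply: integral_ge0 => w _; rewrite lee_fin exprn_ge0.
by move=> w _ /=; rewrite normr0 expr0n gtn_eqF.
Qed.

Implicit Type t : {ffun 'I_q.*2 -> r.-tuple 'I_n}.

(** The AM-GM majorant of a product of terms: it is integrable with integral at most [M]. *)
Let mean t (w : T) : R :=
  \sum_l (q.*2%:R^-1 * `|term (t l) w| ^+ q.*2).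

Let prod_le_mean t w : `|\prod_l term (t l) w| <= mean t w.
Proof. by rewrite normr_prod; exact: prod_le_mean_expn. Qed.

Let meanE t : EFin \o mean t = (fun w =>
  \sum_l (q.*2%:R^-1)%:E * (EFin \o (fun w => `|term (t l) w| ^+ q.*2)%R) w)%E.
Proof. by apply/funext => w; rewrite /= /mean -sumEFin. Qed.

Let integrable_mean t : P.-integrable [set: T] (EFin \o mean t).
Proof.
by rewrite meanE; apply: integrable_sum => // l _; exact: integrableZl.
Qed.

Let integrable_prod t :
  P.-integrable [set: T] (EFin \o (fun w => \prod_l term (t l) w)).
Proof.
apply: le_integrable (integrable_mean t) => //.
  by apply/measurable_EFinP; apply: measurable_prod => l _.
move=> w _ /=; rewrite lee_fin (le_trans (prod_le_mean _ _))//.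
exact: ler_norm.
Qed.

Let integral_prod_le t : (\int[P]_w (\prod_l term (t l) w)%:E <= M%:E)%E.
Proof.
apply: (@le_trans _ _ (\int[P]_w (EFin \o mean t) w)%E).
  apply: le_integral => //; first exact: integrable_prod.
  by move=> w _; rewrite lee_fin (le_trans (ler_norm _)).
rewrite meanE integral_sum//; last by move=> l; exact: integrableZl.
have -> : (M%:E = \sum_(l < q.*2) (q.*2%:R^-1)%:E * M%:E)%E.
  rewrite -EFinM sumEFin sumr_const card_ord -mulrnAl.
  by rewrite -[X in X * M]mulr_natl divff ?mul1r// pnatr_eq0 -lt0n.
apply: lee_sum => l _; rewrite integralZl//.
apply: lee_wpmul2l; first by rewrite lee_fin invr_ge0.
exact: integral_term.
Qed.

(** Either some tuple is not increasing and its term is 0, or some [t l] shares at most [m] indices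
    with the others; in that case the other factors are a function [phi] of a sample on their
    indices, orthogonal to the factor of [t l]. *)
Let integral_prod_eq0 t : t \notin shared_families q.*2 r m.+1 n ->
  (\int[P]_w (\prod_l term (t l) w)%:E = 0)%E.
Proof.
have [/forallP sorted_t|] :=
  boolP [forall l, sorted ltn [seq val j | j <- t l]]; last first.
  rewrite negb_forall => /existsP[l /negbTE tl] _.
  rewrite integral0_eq// => w _.
  by rewrite (bigD1 l)//= /term tl mul0r.
rewrite inE negb_forall => /existsP[l].
have injt l' := injective_sorted (sorted_t l').
have -> /= : uniq (t l).
  by apply: (map_uniq (sorted_uniq ltn_trans ltnn (sorted_t l))).
rewrite -ltnNge ltnS; set U := (\bigcup_(_ | _) _)%SET => tlm.
(* With [2q >= 2] factors there is a second tuple, nonempty as [r > 0]; it supplies the index [j0]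
   of [U]. *)
have [l' l'l] : exists l', l' != l.
  apply/existsP; rewrite -[[exists _, _]]negbK negb_exists.
  apply/negP => /forallP ll.
  have : (#|'I_q.*2| <= #|pred1 l|)%N.
    by apply/subset_leq_card/fintype.subsetP => l' _; rewrite inE -[_ == _]negbK.
  by rewrite card1 card_ord -addnn; case: q q_gt0 => [//|q' _]; rewrite addSn addnS.
pose j0 := tnth (t l') (Ordinal r_gt0).
have jU l1 k : l1 != l -> tnth (t l1) k \in U.
  by move=> l1l; apply/finset.bigcupP; exists l1 => //; rewrite inE mem_tnth.
(* Indices outside [U] are sent to some index of [U], so that [tuple_sample f]
   keeps full length [n] but only involves the X_j with j in U. *)
pose f (j : 'I_n) : nat := if j \in U then j else j0.
have fU j : j \in U -> f j = j by rewrite /f => ->.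
pose phi (v : n.-tuple S) := \prod_(l1 | l1 != l)
  h [tuple tnth v (tnth (t l1) k) | k < r].
have mphi : measurable_fun [set: n.-tuple S] phi.
  rewrite /phi; under eq_fun do rewrite -big_filter.
  apply: measurable_prod => l1 _; apply: measurableT_comp => //.
  apply/measurable_fun_tnthP => k.
  rewrite (_ : _ \o _ = fun v => tnth v (tnth (t l1) k)).
    exact: measurable_tnth.
  by apply/funext => v /=; rewrite tnth_mktuple.
have prodE w : \prod_l1 term (t l1) w =
    h (tuple_sample (fun k => tnth (t l) k) w) * phi (tuple_sample f w).
  rewrite (bigD1 l)//= /term sorted_t; congr (_ * _).
  apply: eq_bigr => l1 l1l; rewrite sorted_t; congr h.
  by apply: eq_from_tnth => k; rewrite !tnth_mktuple fU// jU.
under eq_integral do rewrite prodE.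
apply: integral_degenerate => //.
  apply: leq_trans tlm; have injl : injective (tnth (t l)).
    by move=> j k jk; apply: (injt l); rewrite jk.
  rewrite -(fintype.card_image injl); apply: subset_leq_card.
  apply/fintype.subsetP => j /fintype.imageP[k].
  rewrite inE => /codomP[j' kj'] ->.
  rewrite !inE mem_tnth/=; move: kj'; rewrite /f; case: ifP => [j'U|_] /val_inj-> //.
  exact: jU.
apply: eq_integrable (integrable_prod t) => // w _.
by rewrite /= prodE.
Qed.

Let UstatE w : Ustat h X n w = \sum_(u : r.-tuple 'I_n) term u w.
Proof.
rewrite /Ustat big_mkcond; apply: eq_bigr => t _; rewrite /term.
case: ifP => // _; congr h.
by apply: eq_from_tnth => k; rewrite tnth_map tnth_mktuple.
Qed.

Lemma Ustat_moment : (\int[P]_w (Ustat h X n w ^+ q.*2)%:E <=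
  (#|shared_families q.*2 r m.+1 n|%:R * M)%:E)%E.
Proof.
have -> : (\int[P]_w (Ustat h X n w ^+ q.*2)%:E =
    \int[P]_w (\sum_(t : {ffun 'I_q.*2 -> r.-tuple 'I_n})
      (EFin \o (fun w => \prod_l term (t l) w)%R) w))%E.
  apply: eq_integral => w _; rewrite UstatE -[X in _ ^+ X]card_ord -prodr_const.
  by rewrite bigA_distr_bigA/= sumEFin.
rewrite integral_sum//.
rewrite (bigID (mem (shared_families q.*2 r m.+1 n)))/= [X in (_ + X)%E]big1.
  rewrite adde0 mulr_natl -sumr_const -sumEFin.
  by apply: lee_sum => t _; exact: integral_prod_le.
by move=> t; exact: integral_prod_eq0.
Qed.

Lemma measurable_Ustat : measurable_fun [set: T] (Ustat h X n).
Proof.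
rewrite (_ : Ustat h X n = fun w => \sum_(u : r.-tuple 'I_n) term u w).
  by apply: measurable_sum => u.
by apply/funext => w; exact: UstatE.
Qed.

Lemma Ustat_tail (t : R) : 0 < t ->
  (P [set w | t < `|Ustat h X n w|]%R <=
   (#|shared_families q.*2 r m.+1 n|%:R * M / t ^+ q.*2)%:E)%E.
Proof.
move=> t0; have mU := measurable_Ustat.
pose U : {RV P >-> R} := HB.pack (Ustat h X n)
  (isMeasurableFun.Build _ _ _ _ _ mU).
have tp0 : 0 < t ^+ q.*2 by exact: exprn_gt0.
have mT : measurable [set w | t <= `|Ustat h X n w|].
  rewrite -[X in measurable X]setTI; apply: measurable_fun_le => //.
  exact: measurableT_comp.
apply: (@le_trans _ _ (P [set w | t <= `|Ustat h X n w|])).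
  apply: le_measure; rewrite ?inE//; last by move=> w /= /ltW.
  by apply: measurable_lt_set; exact: measurableT_comp.
rewrite EFinM lee_pdivlMr//.
have := @markov _ _ _ P U (fun x => x ^+ q.*2) t t0.
rewrite unlock /= => H.
rewrite muleC (le_trans (H _ _ _))//.
- by move=> x x0; exact: exprn_ge0.
- by move=> x y x0 y0 xy; rewrite lerXn2r.
apply: le_trans Ustat_moment; rewrite le_eqVlt; apply/orP; left; apply/eqP.
apply: eq_integral => w _ /=.
by rewrite -mul2n !exprM real_normK ?num_real.
Qed.

End moments.

End degenerate.

End iid_samples.

(** * Tail bounds *)

Lemma natural_filtration_measurable d d' (T : measurableType d)
    (S : measurableType d') (R : realType) (P : probability T R)
    (X : nat -> {RV P >-> S}) (m : nat) (A : set T) :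
  natural_filtration X m A -> measurable A.
Proof.
apply: smallest_sub; first exact: sigma_algebra_measurable.
rewrite -bigcup_seq => _ [k _ [C mC <-]].
by rewrite setTI; exact: measurable_funPTI.
Qed.

(** Integrates [expn_le_expR_powR] at [|Y|]. The parameter [b] is free: raising it improves the
    factor in front at the price of a higher order [c] of the exponential moment. *)
Lemma kernel_moment_le d d' (T : measurableType d) (S : measurableType d')
    (R : realType) (P : probability T R) (r : nat) (h : r.-tuple S -> R)
    (X : nat -> {RV P >-> S}) (gamma b : R) (q : nat)
    (c := 2 / gamma * expR (gamma / 2 * b)) :
  measurable_fun [set: r.-tuple S] h -> 0 < gamma -> (0 < q)%N ->
  ('E_P[fun w => expR (c * `|kernel_sample h X w| `^ gamma)] < +oo)%E ->
  P.-integrable [set: T]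
    (EFin \o (fun w => `|kernel_sample h X w| ^+ q.*2)) /\
  (\int[P]_w (`|kernel_sample h X w| ^+ q.*2)%:E <=
   (expR (q%:R * (2 / gamma * ln q%:R - b)))%:E *
   'E_P[fun w => expR (c * `|kernel_sample h X w| `^ gamma)])%E.
Proof.
move=> mh g0 q0; rewrite unlock => Ky.
have mY : measurable_fun [set: T] (kernel_sample h X).
  apply: (measurableT_comp mh); exact: (@measurable_tuple_sample _ _ _ _ _ P X).
have mY2 : measurable_fun [set: T] (fun w => `|kernel_sample h X w| ^+ q.*2).
  by apply: measurable_funX; exact: measurableT_comp.
have mE : measurable_fun [set: T]
    (fun w => expR (c * `|kernel_sample h X w| `^ gamma)).
  apply: measurableT_comp => //; apply: measurable_funM => //.
  apply: (@measurableT_comp _ _ _ _ _ _ (@powR R ^~ gamma)) => //.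
  exact: measurableT_comp.
have le w : `|kernel_sample h X w| ^+ q.*2 <=
    expR (q%:R * (2 / gamma * ln q%:R - b)) *
    expR (c * `|kernel_sample h X w| `^ gamma).
  exact: expn_le_expR_powR.
have bound : (\int[P]_w (`|kernel_sample h X w| ^+ q.*2)%:E <=
   (expR (q%:R * (2 / gamma * ln q%:R - b)))%:E *
   \int[P]_w (expR (c * `|kernel_sample h X w| `^ gamma))%:E)%E.
  rewrite -ge0_integralZl_EFin ?expR_ge0//; last first.
    exact/measurable_EFinP.
  apply: ge0_le_integral => //.
  - exact/measurable_EFinP.
  - by apply: emeasurable_funM => //; exact/measurable_EFinP.
  - by move=> w _; rewrite -EFinM lee_fin.
split=> //; apply/integrableP; split; first exact/measurable_EFinP.
under eq_integral do rewrite /= normrX normr_id.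
apply: le_lt_trans bound _; rewrite lte_mul_pinfty// lee_fin expR_ge0//.
Qed.

Lemma prob_bigmax_lt_le d (T : measurableType d) (R : realType)
    (P : probability T R) (U : nat -> T -> R) (t B : R) (r n : nat) :
  0 <= t -> (forall k, measurable_fun [set: T] (U k)) ->
  (forall k, (k <= n)%N -> (P [set w | t < `|U k w|]%R <= B%:E)%E) ->
  (P [set w | (t < \big[Num.max/0]_(r <= k < n.+1) `|U k w|)%R] <=
   (n.+1%:R * B)%:E)%E.
Proof.
move=> t0 mU PB.
have mA k : measurable [set w | t < `|U k w|].
  by apply: measurable_lt_set; exact: measurableT_comp.
have mmax : measurable_fun [set: T]
    (fun w => \big[Num.max/0]_(r <= k < n.+1) `|U k w|).
  elim: (index_iota r n.+1) => [|k s ih].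
    by under eq_fun do rewrite big_nil; exact: measurable_cst.
  under eq_fun do rewrite big_cons; apply: measurable_maxr => //.
  exact: measurableT_comp.
apply: (@le_trans _ _ (\sum_(k < n.+1) P [set w | t < `|U k w|]%R)%E).
  apply: (@content_subadditive _ _ _ P _ (fun k => [set w | t < `|U k w|])) => //.
    exact: measurable_lt_set.
  rewrite -(bigcup_mkord n.+1 (fun k => [set w | t < `|U k w|])) => w /=.
  (* If no [|U k|] exceeds [t], neither does the maximum; [0 <= t] accounts for its default value
     0. *)
  apply: contraPP => nU.
  apply/negP; rewrite -leNgt big_nat_cond; apply: bigmax_le => // k.
  rewrite andbT => /andP[_ kn]; rewrite leNgt; apply/negP => tU.
  by apply: nU; exists k.
rewrite -[X in X%:R]card_ord mulr_natl -sumr_const -sumEFin.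
by apply: lee_sum => k _; apply: PB; rewrite -ltnS.
Qed.

Theorem theorem1p12 (d d' : measure_display) (T : measurableType d)
    (S : measurableType d') (R : realType) (P : probability T R)
    (r : nat) (hr : (2 <= r)%N)
    (h : r.-tuple S -> R) (hmeas : measurable_fun [set: r.-tuple S] h)
    (hsym : symmetric_kernel h)
    (X : nat -> {RV P >-> S}) (hX : iid X)
    (i : nat) (hi : (2 <= i <= r)%N)
    (hdeg : degenerated_of_order h X i.-1)
    (alpha : R) (halpha : r%:R - i%:R / 2 < alpha < r%:R)
    (gamma : R) (hgamma : 0 < gamma)
    (hexp : forall c : R,
      ('E_P[fun w => expR (c * `|kernel_sample h X w| `^ gamma)] < +oo)%E)
    (eps : R) (heps : 0 < eps) :
  (\sum_(1 <= N <oo)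
     (expR (2 `^ (N%:R * (alpha - (r%:R - i%:R / 2)) *
                  (2 * gamma / (i%:R * gamma + 2)))))%:E *
     P [set w | (eps * 2 `^ (N%:R * alpha) <
                 \big[Num.max/0]_(r <= n < (2 ^ N).+1) `|Ustat h X n w|)%R]
   < +oo)%E.
Proof.
case/andP: halpha => alpha_gt _; case/andP: hi => i2 ir.
have i0 : (0 < i)%N by exact: leq_trans i2.
have r0 : (0 < r)%N by exact: leq_trans hr.
have [iY [Z [_ iZ ZY] Z0] _] := hdeg.
have Y0 A : natural_filtration X i.-1 A ->
    (\int[P]_(w in A) (kernel_sample h X w)%:E = 0)%E.
  move=> FA; rewrite -ZY//.
  have mA : measurable A by exact: natural_filtration_measurable FA.
  rewrite (@ae_eq_integral _ _ _ P A (cst 0%E) (EFin \o Z))//.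
  - by rewrite integral0.
  - exact: measurable_funTS (measurable_int _ iZ).
  - by apply: filterS Z0 => w Zw _ /=; rewrite Zw.
pose s := (2 * r - i)%N.
(* [b], [c] and hence the exponential moment [K] depend neither on [N] nor on [q], so one constant
   serves the whole series. *)
pose b := (i%:R + 2 / gamma) * ln 2 + s%:R + i%:R * ln s%:R - 2 * ln eps + 2 : R.
pose c : R := 2 / gamma * expR (gamma / 2 * b).
pose E := 'E_P[fun w => expR (c * `|kernel_sample h X w| `^ gamma)]%E.
have E0 : (0 <= E)%E by apply: expectation_ge0 => w; exact: expR_ge0.
have Efin : E \is a fin_num by rewrite ge0_fin_numE//; exact: hexp.
pose K := fine E.
have K0 : 0 <= K by exact: fine_ge0.
pose eta := (alpha - (r%:R - i%:R / 2)) * (2 * gamma / (i%:R * gamma + 2)).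
have eta0 : 0 < eta.
  by rewrite mulr_gt0 ?subr_gt0// divr_gt0 ?mulr_gt0// addr_gt0// mulr_gt0// ltr0n.
apply: (@exponential_series_lty _ eta (2 * K)) => //; first exact: mulr_ge0.
  by move=> N; rewrite mule_ge0// lee_fin expR_ge0.
move=> N; rewrite [N%:R * eta]mulrA; set y := 2 `^ _.
pose q := (Num.truncn y).+1.
have q0 : (0 < q)%N by [].
have [iYq YqE] := kernel_moment_le (b := b) hmeas hgamma q0 (hexp c).
pose M := fine (\int[P]_w (`|kernel_sample h X w| ^+ q.*2)%:E)%E.
have YqM : (\int[P]_w (`|kernel_sample h X w| ^+ q.*2)%:E = M%:E)%E.
  by rewrite fineK//; exact: integrable_fin_num iYq.
have ME : M <= expR (q%:R * (2 / gamma * ln q%:R - b)) * K.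
  by rewrite -lee_fin -YqM (le_trans YqE)// -/c -/E EFinM fineK.
pose t := eps * 2 `^ (N%:R * alpha).
have t0 : 0 < t by rewrite mulr_gt0// powR_gt0.
have tail n : (n <= 2 ^ N)%N ->
    (P [set w | t < `|Ustat h X n w|]%R <= (K * expR (- (2 * y)))%:E)%E.
  move=> nN; have := Ustat_tail hX hmeas hsym iY Y0 q0 r0 iYq YqM n t0.
  (* Centring given [F_(i-1)] means that surviving families share at least [(i - 1) + 1 = i]
     indices. *)
  rewrite (prednK i0) => /le_trans; apply; rewrite lee_fin.
  have := shared_families_tail_le r0 ir hgamma heps alpha_gt nN (erefl : q = _).
  rewrite -/s -/b -/t -/y => /(ler_wpM2l K0); apply: le_trans.
  rewrite mulrA ler_wpM2r ?invr_ge0 ?exprn_ge0 ?(ltW t0)//.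
  by rewrite mulrCA ler_wpM2l// mulrC.
apply: (@le_trans _ _ ((expR y)%:E *
    ((2 ^ N).+1%:R * (K * expR (- (2 * y))))%:E)%E).
  rewrite lee_wpmul2l ?lee_fin ?expR_ge0//.
  apply: prob_bigmax_lt_le => //; first exact: ltW.
  by move=> n; exact: measurable_Ustat.
rewrite -EFinM lee_fin.
(* The weight [exp y] uses up half of the decay [exp (- 2 y)]. The constant 2 in [2 * K] comes from
   [2 ^ N + 1 <= 2 * 2 ^ N]. *)
have -> : expR y * ((2 ^ N).+1%:R * (K * expR (- (2 * y)))) =
    K * ((2 ^ N).+1%:R * expR (- y)).
  rewrite [- y](_ : _ = y + - (2 * y)) ?expRD; ring.
rewrite -[leRHS]mulrA [leRHS]mulrCA ler_wpM2l// [leRHS]mulrA ler_wpM2r ?expR_ge0//.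
by rewrite -natrX -natrM ler_nat mul2n -addnn -addn1 leq_add2l expn_gt0.
Qed.
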